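(* Let $Q\in\mathbb{R}^{n\times n}$ be symmetric nonsingular with exactly one negative eigenvalue (and $n-1$ positive eigenvalues), and $A\in\mathbb{R}^{n\times n}$. Then the (nonconvex) set $\mathcal{C_L}\cup(-\mathcal{C_L})=\{x\in\mathbb{R}^n:x^TQx\le0\}$ is an invariant set for the discrete system $x_{k+1}=Ax_k$ (i.e., $x^TQx\le 0$ implies $(Ax)^TQ(Ax)\le0$) if and only if there exists $\mu\ge0$ such that $A^TQA-\mu Q\preceq0$.
   Context: Lorenz cone: for $Q$ symmetric nonsingular with eigenvalues $\lambda_1\ge\dots\ge\lambda_{n-1}>0>\lambda_n$ and orthonormal eigenvectors $u_1,\dots,u_n$ ($Qu_i=\lambda_iu_i$), $\mathcal{C_L}=\{x: x^TQx\le0,\ x^TQu_n\le0\}$. $\preceq0$ denotes negative semidefiniteness. *)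

(* Defs.v *)
From HB Require Import structures.
From mathcomp Require Import all_boot all_order all_algebra.
Set Implicit Arguments. Unset Strict Implicit. Unset Printing Implicit Defensive.
Import Order.TTheory GRing.Theory Num.Theory.
Local Open Scope ring_scope.

Definition qform (R : rcfType) (n : nat) (Q : 'M[R]_n) (x : 'cV[R]_n) : R :=
  (x^T *m Q *m x) 0 0.

Definition nsd (R : rcfType) (n : nat) (M : 'M[R]_n) : Prop :=
  forall x : 'cV[R]_n, qform M x <= 0.

Definition invariant_set (R : rcfType) (n : nat) (A : 'M[R]_n)
  (S : 'cV[R]_n -> Prop) : Prop :=
  forall x, S x -> S (A *m x).

(* Q has exactly one negative eigenvalue and n-1 positive eigenvalues
   (eigenvalues counted with multiplicity = roots of the characteristic polynomial) *)
Definition one_neg_rest_pos_eig (R : rcfType) (n : nat) (Q : 'M[R]_n) : Prop :=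
  exists (lam : 'I_n -> R) (i0 : 'I_n),
    lam i0 < 0 /\ (forall i, i != i0 -> 0 < lam i) /\
    char_poly Q = \prod_(i < n) ('X - (lam i)%:P).

(* Main.v *)
Require Import Defs.
From HB Require Import structures.
From mathcomp Require Import all_boot all_order all_algebra.
From mathcomp Require Import perm ring lra.
From mathcomp Require complex.
Import Order.TTheory GRing.Theory Num.Theory.
Local Open Scope ring_scope.

(* The forward implication is an S-lemma for P = A^T Q A.  In suitable
   coordinates (s, w), Q becomes |w|^2 - s^2 and P becomes
   c s^2 + 2 s <b, w> + sum_i p_i w_i^2.  There are t >= max_i p_i and a unit
   vector v with b_i = v_i (t - p_i) for all i: this is the root of the secular
   equation sum_i (b_i / (t - p_i))^2 = 1, or t = max_i p_i in the degenerate
   case.  Completing squares gives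
     P(s, w) - t Q(s, w) = s^2 P(1, v) - sum_i (t - p_i) (w_i - s v_i)^2,
   and P(1, v) <= 0 because Q(1, v) = 0.  If t < 0 then P itself is negative
   semidefinite and mu = 0 works.  Only roots of polynomials are needed, so no
   completeness of the ground field is used. *)

(** * Real spectra of symmetric matrices *)

Lemma char_poly_conj (R : comNzRingType) n (P A P' : 'M[R]_n) :
  P' *m P = 1%:M -> char_poly (P *m A *m P') = char_poly A.
Proof.
move=> PP'; have PP := mulmx1C PP'.
rewrite /char_poly.
have -> : char_poly_mx (P *m A *m P') = map_mx polyC P *m char_poly_mx A *m map_mx polyC P'.
  rewrite /char_poly_mx mulmxBr mulmxBl !map_mxM mul_mx_scalar -scalemxAl.
  by rewrite -[map_mx _ P *m map_mx _ P']map_mxM PP map_mx1 scalemx1.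
transitivity (\det (map_mx polyC P' *m map_mx polyC P) * \det (char_poly_mx A)).
  by rewrite !det_mulmx; ring.
by rewrite -map_mxM PP' map_mx1 det1 mul1r.
Qed.

Section Splitting.
Import complex.
Local Open Scope complex_scope.

(** Over [R[i]] the matrix is Hermitian, hence unitarily diagonalizable with real spectrum; the
    factorization descends to [R] because the embedding of polynomials is injective. *)
Lemma symmetric_char_poly_split (R : rcfType) n (S : 'M[R]_n) :
  S^T = S -> exists d : 'I_n -> R, char_poly S = \prod_i ('X - (d i)%:P).
Proof.
move=> Ssym; pose SC : 'M[R[i]]_n := map_mx (real_complex R) S.
have SCherm : SC \is hermitianmx _ false Num.conj.
  apply: realsym_hermsym.
    by apply/is_hermitianmxP; rewrite expr0 scale1r map_mx_id // /SC map_trmx Ssym.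
  by apply/mxOverP => i j; rewrite mxE complex_real.
have /orthomx_spectralP SCE := hermitian_normalmx SCherm.
have /mxOverP Dreal := hermitian_spectral_diag_real SCherm.
set P := spectralmx SC in SCE; set D := spectral_diag SC in SCE Dreal.
exists (fun i => Re (D 0 i)).
apply: (map_inj_poly (@complexI R) (rmorph0 _)).
rewrite map_char_poly -/SC SCE char_poly_conj; last first.
  by rewrite mulmxV ?spectral_unit.
rewrite char_poly_trig; last exact/diag_mx_is_trig.
rewrite rmorph_prod; apply: eq_bigr => i _.
by rewrite rmorphB /= map_polyX map_polyC /= !mxE eqxx mulr1n RRe_real.
Qed.
End Splitting.

(** * Orthogonal diagonalization over a real closed field *)

Lemma trmx_congr (R : comNzRingType) m n (M : 'M[R]_m) (T : 'M[R]_(m, n)) :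
  M^T = M -> (T^T *m M *m T)^T = T^T *m M *m T.
Proof. by move=> Msym; rewrite !trmx_mul trmxK Msym mulmxA. Qed.

Lemma dot_cV (R : comNzRingType) n (x : 'cV[R]_n) :
  x^T *m x = (\sum_i x i 0 ^+ 2)%:M.
Proof.
apply/matrixP => i j; rewrite !ord1 !mxE mulr1n.
by apply: eq_bigr => k _; rewrite !mxE expr2.
Qed.

Lemma dot_cV_gt0 {R : realDomainType} {n} {x : 'cV[R]_n} :
  x != 0 -> 0 < \sum_i x i 0 ^+ 2.
Proof.
move=> /cV0Pn[i xi]; rewrite (bigD1 i) //= ltr_wpDr ?sumr_ge0 //.
- by move=> j _; rewrite sqr_ge0.
- by rewrite lt0r sqr_ge0 sqrf_eq0 xi.
Qed.

Lemma orthogonal_first_col {R : realFieldType} {n} {v : 'cV[R]_n.+1} :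
  \sum_i v i 0 ^+ 2 = 1 ->
  exists2 H : 'M[R]_n.+1, H^T *m H = 1%:M & H *m delta_mx 0 0 = v.
Proof.
(* H is the Householder reflection exchanging the first basis vector and v. *)
move=> v1; pose e : 'cV[R]_n.+1 := delta_mx 0 0.
have [w0 | wN0] := eqVneq (v - e) 0.
  by exists 1%:M; rewrite ?trmx1 !mul1mx //; apply/esym/eqP; rewrite -subr_eq0; apply/eqP.
set w := v - e in wN0; have := dot_cV_gt0 wN0; set c := \sum_i _ => c0.
have wE i : w i 0 = v i 0 - (i == 0)%:R by rewrite /w !mxE andbT.
(* Both [v] and [e] are unit vectors, so |v - e|^2 = 2 - 2 v_0. *)
have cE : c = 2 * (1 - v 0 0).
  rewrite /c big_ord_recl wE eqxx.
  under eq_bigr do rewrite wE subr0.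
  by move: v1; rewrite big_ord_recl /=; nra.
have we : w^T *m e = (v 0 0 - 1)%:M.
  by apply/matrixP => i j; rewrite !ord1 -colE !mxE eqxx mulr1n.
have HT : (1%:M - (2 / c) *: (w *m w^T))^T = 1%:M - (2 / c) *: (w *m w^T).
  by rewrite linearB /= trmx1 linearZ /= trmx_mul trmxK.
exists (1%:M - (2 / c) *: (w *m w^T)).
  set K := w *m w^T; have KK : K *m K = c *: K.
    by rewrite /K -mulmxA (mulmxA w^T) dot_cV -/c mul_scalar_mx scalemxAr.
  rewrite HT -/K mulmxBl mul1mx mulmxBr mulmx1 -scalemxAl -scalemxAr KK !scalerA.
  have -> : 2 / c * (2 / c) * c = 2 / c + 2 / c by field; lra.
  by rewrite scalerDl opprB addrK subrK.
rewrite mulmxBl mul1mx -scalemxAl -mulmxA -/e we mul_mx_scalar scalerA.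
have -> : 2 / c * (v 0 0 - 1) = -1 by rewrite cE; field; lra.
by rewrite scaleN1r opprK addrC subrK.
Qed.

Lemma char_poly_block_diag (R : comNzRingType) m n (A : 'M[R]_m) (B : 'M[R]_n) :
  char_poly (block_mx A 0 0 B) = char_poly A * char_poly B.
Proof. by rewrite /char_poly char_block_diag_mx det_ublock. Qed.

(** Deflation: an orthogonal change of basis puts a unit eigenvector for [d 0 0] first, symmetry
    splits off a block of size 1, and induction treats the rest. The order of [d] is prescribed so
    that a chosen eigenvalue can come first. *)
Lemma real_spectral (R : rcfType) n (S : 'M[R]_n) (d : 'rV[R]_n) :
  S^T = S -> char_poly S = \prod_i ('X - (d 0 i)%:P) ->
  exists2 U : 'M[R]_n, U^T *m U = 1%:M & U^T *m S *m U = diag_mx d.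
Proof.
elim: n S d => [|n IHn] S d Ssym Sd.
  by exists 1%:M; apply/matrixP => -[].
have : eigenvalue S (d 0 0).
  by rewrite eigenvalue_root_char Sd big_ord_recl rootM root_XsubC eqxx.
move=> /eigenvalueP[v vS v0].
have vT0 : v^T != 0 by rewrite trmx_eq0.
have := dot_cV_gt0 vT0; set c := \sum_i _ => c0.
(* [v] is a row eigenvector; by symmetry its transpose is a column eigenvector, normalized here. *)
pose x := (Num.sqrt c)^-1 *: v^T.
have x1 : \sum_i x i 0 ^+ 2 = 1.
  under eq_bigr do rewrite mxE exprMn exprVn sqr_sqrtr ?(ltW c0) //.
  by rewrite -mulr_sumr -/c mulVf // gt_eqF.
have Sx : S *m x = d 0 0 *: x.
  by rewrite /x -scalemxAr -{1}Ssym -trmx_mul vS linearZ /= scalerA mulrC -scalerA.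
have [H HH Hx] := orthogonal_first_col x1.
have [S1 S1def] : {S1 : 'M[R]_(1 + n) | S1 = H^T *m S *m H} by exists (H^T *m S *m H).
have S1sym : S1^T = S1 by rewrite S1def; exact: trmx_congr.
have S1e : S1 *m delta_mx 0 0 = d 0 0 *: delta_mx 0 0 :> 'cV_(1 + n).
  by rewrite S1def -!mulmxA Hx Sx -scalemxAr -Hx mulmxA HH mul1mx.
have S1col i : S1 i 0 = d 0 0 *+ (i == 0).
  move/matrixP/(_ i 0): S1e; rewrite -colE !mxE => ->.
  by rewrite eqxx andbT mulr_natr.
have S1row i : S1 0 i = d 0 0 *+ (i == 0) by rewrite -S1sym mxE S1col.
pose B : 'M[R]_n := drsubmx S1.
have S1E : S1 = block_mx (d 0 0)%:M 0 0 B.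
  rewrite -[S1]submxK; congr block_mx.
  - by apply/matrixP => i j; rewrite !ord1 !mxE lshift0 S1col eqxx.
  - by apply/matrixP => i j; rewrite !ord1 !mxE lshift0 S1row.
  - by apply/matrixP => i j; rewrite !ord1 !mxE lshift0 S1col.
have Bsym : B^T = B by rewrite /B trmx_drsub S1sym.
have dE : d = row_mx (d 0 0)%:M (rsubmx (d : 'rV_(1 + n))) :> 'rV_(1 + n).
  rewrite -[LHS](@hsubmxK _ 1 1 n); congr row_mx.
  by apply/matrixP => i j; rewrite !ord1 !mxE lshift0 mulr1n.
have Bd : char_poly B = \prod_i ('X - (rsubmx (d : 'rV_(1 + n)) 0 i)%:P).
  (* Multiplied by the linear factor of [d 0 0], both sides become [char_poly S]. *)
  apply: (mulfI (negbT (polyXsubC_eq0 (d 0 0)))).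
  have <- : char_poly ((d 0 0)%:M : 'M[R]_1) = 'X - (d 0 0)%:P.
    by rewrite char_poly_trig ?scalar_mx_is_trig // big_ord1 mxE mulr1n.
  rewrite -char_poly_block_diag -S1E S1def char_poly_conj; last exact: mulmx1C.
  rewrite Sd big_ord_recl char_poly_trig ?scalar_mx_is_trig // big_ord1 mxE mulr1n.
  by congr (_ * _); apply: eq_bigr => i _; rewrite mxE; do 4! f_equal; exact: val_inj.
have [V VV VB] := IHn _ _ Bsym Bd.
pose W : 'M[R]_(1 + n) := block_mx 1%:M 0 0 V.
have WT : W^T = block_mx 1%:M 0 0 V^T by rewrite tr_block_mx trmx1 !trmx0.
have WW : W^T *m W = 1%:M.
  rewrite WT mulmx_block !mulmx1 !mul0mx !mulmx0 !add0r !addr0 VV.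
  by rewrite -scalar_mx_block.
have WS : W^T *m S1 *m W = diag_mx (d : 'rV_(1 + n)).
  rewrite S1E WT !mulmx_block !(mulmx1, mul1mx, mul0mx, mulmx0, add0r, addr0) VB.
  rewrite [in RHS]dE diag_mx_row; congr block_mx.
  by apply/matrixP => i j; rewrite !ord1 !mxE mulr1n.
exists (H *m W : 'M[R]_(1 + n)).
  by rewrite trmx_mul mulmxA -(mulmxA _ H^T) HH mulmx1; exact: WW.
by rewrite trmx_mul !mulmxA -(mulmxA W^T) -(mulmxA W^T) -S1def; exact: WS.
Qed.

(** * The secular equation *)

(** Multiplying 1 - f by the positive [h] clears denominators and gives the polynomial [g], to which
    the intermediate value theorem for polynomials applies. *)
Lemma secular_root (R : rcfType) (I : finType) (J : pred I) (p b : I -> R) (t0 : R) :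
  (forall i, J i -> p i < t0) -> 1 <= \sum_(i | J i) (b i / (t0 - p i)) ^+ 2 ->
  exists2 t, t0 <= t & \sum_(i | J i) (b i / (t - p i)) ^+ 2 = 1.
Proof.
move=> pt0 sum_t0; pose f t := \sum_(i | J i) (b i / (t - p i)) ^+ 2.
pose h : {poly R} := \prod_(i | J i) ('X - (p i)%:P) ^+ 2.
pose g := h - \sum_(i | J i) (b i ^+ 2)%:P * \prod_(j | J j && (j != i)) ('X - (p j)%:P) ^+ 2.
have h_gt0 t : t0 <= t -> 0 < h.[t].
  move=> t0t; rewrite horner_prod prodr_gt0 // => i Ji.
  by rewrite !hornerE exprn_gt0 // subr_gt0 (lt_le_trans (pt0 _ Ji)).
have gE t : t0 <= t -> g.[t] = h.[t] * (1 - f t).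
  move=> t0t; rewrite hornerD hornerN horner_sum mulrBr mulr1 mulr_sumr.
  congr (_ - _); apply: eq_bigr => i Ji.
  have tp : t - p i != 0 by rewrite subr_eq0 gt_eqF // (lt_le_trans (pt0 _ Ji)).
  rewrite /h [in RHS](bigD1 i) //= !hornerM hornerC hornerXsubC -expr2.
  by set u := horner _ _; field.
pose B := \sum_(i | J i) b i ^+ 2.
have B0 : 0 <= B by apply: sumr_ge0 => i _; rewrite sqr_ge0.
(* At this right end each squared denominator is at least 1 + B, so f <= B / (1 + B) <= 1. *)
have t0t1 : t0 <= t0 + 1 + B by lra.
have ft1 : f (t0 + 1 + B) <= 1.
  apply: (@le_trans _ _ (\sum_(i | J i) b i ^+ 2 / (1 + B))).
    apply: ler_sum => i Ji; rewrite expr_div_n ler_wpM2l ?sqr_ge0 //.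
    have := pt0 i Ji => pi.
    by rewrite lef_pV2 ?posrE; [nra | rewrite exprn_gt0; lra | lra].
  by rewrite -mulr_suml -/B ler_pdivrMr; lra.
have [] := @poly_ivt _ g t0 (t0 + 1 + B) t0t1.
  rewrite !gE // pmulr_rle0 ?h_gt0 // pmulr_rge0 ?h_gt0 //.
  by rewrite subr_le0 subr_ge0 ft1 sum_t0.
move=> t /andP[t0t _] /rootP; rewrite gE // => /eqP.
rewrite mulf_eq0 gt_eqF ?h_gt0 //= subr_eq0 => /eqP ft.
by exists t.
Qed.

(** These are the conditions for [w] to maximize sum p_i w_i^2 + 2 sum b_i w_i on the unit sphere:
    b_i + p_i w_i = t w_i is stationarity with multiplier [t], and p_i <= t makes the maximum
    global. *)
Lemma secular_equation (R : rcfType) m (p b : 'I_m.+1 -> R) :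
  exists (t : R) (w : 'I_m.+1 -> R), [/\ forall i, p i <= t,
    \sum_i w i ^+ 2 = 1 & forall i, b i = w i * (t - p i)].
Proof.
have [k _ pk] := @arg_maxP _ _ _ ord0 predT p isT.
have {}pk i : p i <= p k by exact: pk.
pose f t := \sum_i (b i / (t - p i)) ^+ 2.
(* The terms with b i = 0 vanish, even for t = p i, where x / 0 = 0. *)
have fJ t : f t = \sum_(i | b i != 0) (b i / (t - p i)) ^+ 2.
  rewrite /f (bigID (fun i => b i != 0)) /= [X in _ + X]big1 ?addr0 // => i.
  by rewrite negbK => /eqP->; rewrite mul0r expr0n.
have solution t0 : p k <= t0 -> (forall i, b i != 0 -> p i < t0) -> 1 <= f t0 ->
    exists (t : R) (w : 'I_m.+1 -> R), [/\ forall i, p i <= t,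
      \sum_i w i ^+ 2 = 1 & forall i, b i = w i * (t - p i)].
  move=> kt0 bt0; rewrite fJ => /(secular_root _ _ _ _ _ _ bt0)[t t0t ft].
  exists t, (fun i => b i / (t - p i)); split.
  - by move=> i; rewrite (le_trans (pk i)) // (le_trans kt0).
  - by rewrite -[LHS]fJ in ft *.
  - move=> i; have [->|bi] := eqVneq (b i) 0; first by rewrite !mul0r.
    by rewrite divfK // subr_eq0 gt_eqF // (lt_le_trans (bt0 _ bi)).
have [/existsP[i /andP[/eqP pi bi]]|/existsPn noi] :=
    boolP [exists i, (p i == p k) && (b i != 0)].
  have bi0 : 0 < `|b i| by rewrite normr_gt0.
  (* As p_i = p_k, the i-th term alone equals 1 at this point. *)
  apply: (solution (p k + `|b i|)).
  - by rewrite lerDl ltW.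
  - by move=> j _; have := pk j; lra.
  - rewrite /f (bigD1 i) //= pi (addrC (p k)) addrK expr_div_n real_normK ?num_real //.
    by rewrite divff ?sqrf_eq0 // lerDl sumr_ge0 // => j _; rewrite sqr_ge0.
(* Now no index with b_i nonzero attains the maximum, so [p k] itself is not a pole of f. *)
have lt_pk i : b i != 0 -> p i < p k.
  by move=> bi; rewrite lt_neqAle pk andbT; move: (noi i); rewrite bi andbT.
have bk : b k = 0 by apply/eqP/negP => /negP/lt_pk; rewrite ltxx.
(* If f (p k) < 1, taking t = p k leaves the k-th coordinate of w free. *)
have [f1|f1] := leP 1 (f (p k)); first exact: (solution (p k)).
exists (p k), (fun i => if i == k then Num.sqrt (1 - f (p k)) else b i / (p k - p i)).
split=> // [|i].
  rewrite (bigD1 k) //= eqxx sqr_sqrtr ?subr_ge0 1?ltW //.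
  rewrite (eq_bigr (fun i => (b i / (p k - p i)) ^+ 2)); last by move=> i /negPf->.
  by rewrite /f [in X in _ - X](bigD1 k) //= bk mul0r expr0n add0r subrK.
case: eqVneq => [->|_]; first by rewrite subrr mulr0.
have [->|bi] := eqVneq (b i) 0; first by rewrite !mul0r.
by rewrite divfK // subr_eq0 gt_eqF // lt_pk.
Qed.

(** * The S-lemma in Lorentz coordinates *)

Lemma lorentz_S_lemma (R : rcfType) m (c : R) (b p : 'rV[R]_m) :
  let P s (w : 'cV[R]_m) :=
    c * s ^+ 2 + s * (\sum_i b 0 i * w i 0) *+ 2 + \sum_i p 0 i * w i 0 ^+ 2 in
  (forall s (w : 'cV[R]_m), \sum_i w i 0 ^+ 2 <= s ^+ 2 -> P s w <= 0) ->
  exists2 mu, 0 <= mu & forall s (w : 'cV[R]_m), P s w <= mu * (\sum_i w i 0 ^+ 2 - s ^+ 2).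
Proof.
case: m b p => [|m] b p P P_le0.
  (* With no coordinates in [w] the cone is the whole line, so [P] is nonpositive everywhere. *)
  exists 0 => // s w; rewrite mul0r; apply: P_le0.
  by rewrite big_ord0 sqr_ge0.
have [t [w0 [pt w1 bE]]] := secular_equation _ _ (p 0) (b 0).
have [v vE] : {v : 'cV[R]_m.+1 | forall i, v i 0 = w0 i}.
  by exists (\col_i w0 i) => i; rewrite mxE.
have {}w1 : \sum_i v i 0 ^+ 2 = 1 by under eq_bigr do rewrite vE.
have Pt s (w : 'cV[R]_m.+1) : P s w <= t * (\sum_i w i 0 ^+ 2 - s ^+ 2).
  rewrite -subr_le0.
  have -> : P s w - t * (\sum_i w i 0 ^+ 2 - s ^+ 2) =
      s ^+ 2 * P 1 v - \sum_i (t - p 0 i) * (w i 0 - v i 0 * s) ^+ 2.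
    (* Keeping the factor |v|^2 in the last term makes the identity hold coordinate by coordinate;
       |v| = 1 is substituted afterwards. *)
    have sumsE :
        s * (\sum_i b 0 i * w i 0) *+ 2 + \sum_i p 0 i * w i 0 ^+ 2 - t * \sum_i w i 0 ^+ 2 =
        s ^+ 2 * ((\sum_i b 0 i * v i 0) *+ 2 + \sum_i p 0 i * v i 0 ^+ 2)
        - \sum_i (t - p 0 i) * (w i 0 - v i 0 * s) ^+ 2 - t * s ^+ 2 * \sum_i v i 0 ^+ 2.
      rewrite -!mulrnAr -!sumrMnl !mulr_sumr -!sumrN -!big_split /= mulr_sumr -!big_split /=.
      by apply: eq_bigr => i _; rewrite bE -vE; ring.
    by move: sumsE; rewrite w1 /P; lra.
  have := P_le0 1 v; rewrite w1 expr1n lexx => /(_ isT) Pv.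
  rewrite -opprB oppr_le0 subr_ge0 (@le_trans _ _ 0) ?mulr_ge0_le0 ?sqr_ge0 //.
  by apply: sumr_ge0 => i _; rewrite mulr_ge0 ?sqr_ge0 // subr_ge0.
have [t0|t0] := leP 0 t; first by exists t.
exists 0 => // s w; rewrite mul0r.
(* Inside the cone the hypothesis applies; outside, Q > 0 and t < 0 give P <= t Q <= 0. *)
have [|ws] := leP (\sum_i w i 0 ^+ 2) (s ^+ 2); first exact: P_le0.
by apply: le_trans (Pt s w) _; rewrite nmulr_rle0 // subr_ge0 ltW.
Qed.

(** * Quadratic forms and the simultaneous normal form *)

Lemma qform_congr (R : rcfType) n (M T : 'M[R]_n) (x : 'cV[R]_n) :
  qform M (T *m x) = qform (T^T *m M *m T) x.
Proof. by rewrite /qform trmx_mul !mulmxA. Qed.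

Lemma qformBZ (R : rcfType) n (M N : 'M[R]_n) (a : R) (x : 'cV[R]_n) :
  qform (M - a *: N) x = qform M x - a * qform N x.
Proof. by rewrite /qform mulmxBr mulmxBl -scalemxAr -scalemxAl !mxE. Qed.

(** One block shape serves both forms: c = -1, b = 0, p = 1 gives |w|^2 - s^2. *)
Lemma qform_block_diag (R : rcfType) m (c s : R) (b p : 'rV[R]_m) (w : 'cV[R]_m) :
  qform (block_mx c%:M b b^T (diag_mx p)) (col_mx s%:M w) =
  c * s ^+ 2 + s * (\sum_i b 0 i * w i 0) *+ 2 + \sum_i p 0 i * w i 0 ^+ 2.
Proof.
have bw : (b *m w) 0 0 = \sum_i b 0 i * w i 0 by rewrite mxE.
have wb : (w^T *m b^T) 0 0 = \sum_i b 0 i * w i 0 by rewrite -trmx_mul mxE.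
have ww : (w^T *m diag_mx p *m w) 0 0 = \sum_i p 0 i * w i 0 ^+ 2.
  rewrite -mulmxA mxE; apply: eq_bigr => i _.
  by rewrite mul_diag_mx !mxE; ring.
rewrite /qform tr_col_mx mul_row_block mul_row_col tr_scalar_mx !mulmxDl.
rewrite !mul_scalar_mx !mul_mx_scalar -!scalemxAl.
have addE (X Y : 'M[R]_1) : (X + Y) 0 0 = X 0 0 + Y 0 0 by rewrite mxE.
have scaleE a (X : 'M[R]_1) : (a *: X) 0 0 = a * X 0 0 by rewrite mxE.
by rewrite !(addE, scaleE) bw wb ww !mxE eqxx !mulr1n; ring.
Qed.

(** [T] has three factors: an orthogonal [U] diagonalizing [Q], a scaling of the eigenvalues to
    signs, and 1 + [V] in block form, with [V] orthogonal and diagonalizing the lower corner of [P].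
    The last preserves |w|^2 - s^2. The row [b] remains, since two indefinite forms need not be
    simultaneously diagonalizable. *)
Lemma simultaneous_normal_form (R : rcfType) m (Q P : 'M[R]_(1 + m)) :
  Q^T = Q -> P^T = P -> one_neg_rest_pos_eig Q ->
  exists (T : 'M[R]_(1 + m)) (c : R) (b p : 'rV[R]_m),
  [/\ T \in unitmx,
      T^T *m Q *m T = block_mx (-1)%:M 0 0^T (diag_mx (const_mx 1)) &
      T^T *m P *m T = block_mx c%:M b b^T (diag_mx p)].
Proof.
move=> Qsym Psym [lam [i0 [lam_neg [lam_pos Qlam]]]].
have [d [Qd d0 dS]] : exists d : 'rV[R]_(1 + m),
    [/\ char_poly Q = \prod_i ('X - (d 0 i)%:P), d 0 0 < 0 & forall i, i != 0 -> 0 < d 0 i].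
  (* The transposition moves the negative eigenvalue to index 0. *)
  exists (\row_i lam (tperm i0 0 i)); split; last 1 first.
  - move=> i i_neq0; rewrite mxE lam_pos //; apply: contra i_neq0 => /eqP i_eq.
    by rewrite -(tpermK i0 0 i) i_eq tpermL.
  - rewrite Qlam (reindex_inj (@perm_inj _ (tperm i0 0))).
    by apply: eq_bigr => i _; rewrite mxE.
  - by rewrite mxE tpermR.
have [U UU UQ] := real_spectral _ _ _ _ Qsym Qd.
have dN0 i : `|d 0 i| != 0.
  by rewrite normr_eq0; have [->|/dS/gt_eqF->//] := eqVneq i 0; rewrite lt_eqF.
pose e : 'rV[R]_(1 + m) := \row_i (Num.sqrt `|d 0 i|)^-1.
have ede : diag_mx e *m diag_mx d *m diag_mx e =
    block_mx (-1)%:M 0 0^T (diag_mx (const_mx 1)).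
  have -> : block_mx (-1)%:M 0 0^T (diag_mx (const_mx 1)) =
      diag_mx (row_mx (-1)%:M (const_mx 1)) :> 'M[R]_(1 + m).
    rewrite diag_mx_row trmx0; congr block_mx.
    by apply/matrixP => i j; rewrite !ord1 !mxE mulr1n.
  rewrite !mulmx_diag; congr diag_mx; apply/rowP => i; rewrite !mxE.
  have -> : (Num.sqrt `|d 0 i|)^-1 * d 0 i * (Num.sqrt `|d 0 i|)^-1 = Num.sg (d 0 i).
    rewrite mulrAC -expr2 exprVn sqr_sqrtr ?normr_ge0 // {2}(numEsg (d 0 i)).
    by rewrite mulrCA mulVf // mulr1.
  case: split_ordP => j -> /=; rewrite !mxE.
    by rewrite ord1 lshift0 ltr0_sg // eqxx.
  by rewrite gtr0_sg // dS.
have Uunit : U \in unitmx by have [] := mulmx1_unit UU.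
have eunit : diag_mx e \in unitmx.
  rewrite unitmxE det_diag unitfE; apply/prodf_neq0 => i _.
  by rewrite mxE invr_eq0 sqrtr_eq0 -ltNge lt_def dN0 normr_ge0.
pose T1 := U *m diag_mx e.
pose P1 := T1^T *m P *m T1.
have P1sym : P1^T = P1 by exact: trmx_congr.
have Bsym : (drsubmx P1)^T = drsubmx P1 by rewrite trmx_drsub P1sym.
(* The eigenvalues of [Q] are given, but those of this block must be shown to lie in [R]. *)
have [dB BdB] := symmetric_char_poly_split _ _ _ Bsym.
have [|V VV VB] := real_spectral _ _ (drsubmx P1) (\row_i dB i) Bsym.
  by rewrite BdB; apply: eq_bigr => i _; rewrite mxE.
pose W : 'M[R]_(1 + m) := block_mx 1%:M 0 0 V.
have WT : W^T = block_mx 1%:M 0 0 V^T by rewrite tr_block_mx trmx1 !trmx0.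
exists (T1 *m W), (ulsubmx P1 0 0), (ursubmx P1 *m V), (\row_i dB i); split.
- rewrite !unitmx_mul Uunit eunit /= unitmxE det_ublock det1 mul1r -unitmxE.
  by have [] := mulmx1_unit VV.
- have -> : (T1 *m W)^T *m Q *m (T1 *m W) = W^T *m (diag_mx e *m (U^T *m Q *m U) *m diag_mx e) *m W.
    by rewrite /T1 !trmx_mul tr_diag_mx !mulmxA.
  rewrite UQ ede WT !mulmx_block !(trmx0, mulmx1, mul1mx, mul0mx, mulmx0, add0r, addr0).
  by rewrite diag_const_mx mulmx1 VV.
- have -> : (T1 *m W)^T *m P *m (T1 *m W) = W^T *m P1 *m W.
    by rewrite /P1 !trmx_mul !mulmxA.
  rewrite -{1}[P1]submxK WT !mulmx_block.
  rewrite !(mulmx1, mul1mx, mul0mx, mulmx0, add0r, addr0) VB -mx11_scalar.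
  by rewrite trmx_mul trmx_ursub P1sym.
Qed.

(** * Invariance of the double cone under the discrete system *)

Theorem theorem3p16 (R : rcfType) (n : nat) (Q A : 'M[R]_n) :
  Q^T = Q -> Q \in unitmx -> one_neg_rest_pos_eig Q ->
  (invariant_set A (fun x => qform Q x <= 0) <->
   exists mu : R, 0 <= mu /\ nsd (A^T *m Q *m A - mu *: Q)).
Proof.
move=> Qsym _ Qlorentz; split; last first.
  (* Here Q(Ax) <= mu Q(x) <= 0. *)
  move=> [mu [mu0 Mnsd]] x Qx; rewrite qform_congr.
  have := Mnsd x; rewrite qformBZ subr_le0 => /le_trans->//.
  by rewrite mulr_ge0_le0.
case: n Q A Qsym Qlorentz => [|m] Q A Qsym Qlorentz inv.
  (* Size 0 is excluded because the negative eigenvalue needs an index. *)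
  by case: Qlorentz => lam [[]].
pose P := A^T *m Q *m A.
have Psym : P^T = P by exact: trmx_congr.
have [T [c [b [p [Tunit TQ TP]]]]] := @simultaneous_normal_form R m Q P Qsym Psym Qlorentz.
have QT s w : qform Q (T *m col_mx s%:M w) = \sum_i w i 0 ^+ 2 - s ^+ 2.
  rewrite qform_congr TQ qform_block_diag.
  under eq_bigr do rewrite mxE mul0r.
  under [X in _ + X]eq_bigr do rewrite mxE mul1r.
  by rewrite big1 // mulr0 mul0rn addr0 mulN1r addrC.
have PT s w : qform P (T *m col_mx s%:M w) =
    c * s ^+ 2 + s * (\sum_i b 0 i * w i 0) *+ 2 + \sum_i p 0 i * w i 0 ^+ 2.
  by rewrite qform_congr TP qform_block_diag.
have [|mu mu0 Pmu] := lorentz_S_lemma _ m c b p.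
  (* The cone |w| <= |s| is the set Q <= 0, so invariance gives P(x) = Q(Ax) <= 0 on it. *)
  by move=> s w ws; rewrite -PT -qform_congr; apply: inv; rewrite QT subr_le0.
exists mu; split => // x.
(* As [T] is invertible, every vector has coordinates (s, w). *)
have [s [w ->]] : exists s w, x = T *m col_mx s%:M w.
  pose y : 'cV[R]_(1 + m) := invmx T *m x.
  exists (usubmx y 0 0), (dsubmx y).
  by rewrite -mx11_scalar vsubmxK mulKVmx.
by rewrite qformBZ subr_le0 PT QT; exact: Pmu.
Qed.
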